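(* For every integer $m\geq 1$, the sequence $\{H_{n,m}\}_{n\geq 1}$ of generalized harmonic numbers $H_{n,m}=\sum_{k=1}^n k^{-m}$ is ratio log-convex.
   Context: A sequence $(x_n)_{n\ge p}$ of positive reals is log-convex if $x_n^2\le x_{n-1}x_{n+1}$ for all $n\ge p+1$. A sequence $(a_n)_{n\ge p}$ of positive reals is ratio log-convex if $(a_{n+1}/a_n)_{n\ge p}$ is log-convex. *)

(* Defs.v *)
From mathcomp Require Import all_boot all_order all_algebra.
From mathcomp Require Import reals.

Set Implicit Arguments.
Unset Strict Implicit.
Unset Printing Implicit Defensive.

Import Order.TTheory GRing.Theory Num.Theory.
Local Open Scope ring_scope.

(* A sequence (x_n)_{n >= p} is a total function nat -> R of which only the
   values at indices n >= p are constrained. *)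
Definition positive_from (R : realType) (p : nat) (x : nat -> R) : Prop :=
  forall n : nat, (p <= n)%N -> 0 < x n.

Definition log_convex (R : realType) (p : nat) (x : nat -> R) : Prop :=
  positive_from p x /\
  forall n : nat, (p + 1 <= n)%N -> x n ^+ 2 <= x (n - 1)%N * x (n + 1)%N.

Definition ratio_log_convex (R : realType) (p : nat) (a : nat -> R) : Prop :=
  positive_from p a /\ log_convex p (fun n => a (n + 1)%N / a n).

Definition gen_harmonic (R : realType) (m n : nat) : R :=
  \sum_(1 <= k < n.+1) k%:R ^- m.

(* Main.v *)
Require Import Defs.
From mathcomp Require Import all_boot all_order all_algebra.
From mathcomp Require Import reals.
From mathcomp Require Import ring zify.

Import Order.TTheory GRing.Theory Num.Theory.
Local Open Scope ring_scope.

(** Write [h = H_{n,m}] and [a, b, c] for the [m]-th powers of [1/n], [1/(n+1)],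
    [1/(n+2)]. After clearing denominators the claim is
    [(h + b)^3 (h - a) <= h^3 (h + b + c)], and the difference of the two sides is
    [h^3 (a + c - 2b) + 3 h^2 b (a - b) + h b^2 (3a - b) + a b^3].
    Every term is nonnegative because [k |-> k^-m] is nonincreasing and convex. *)

Lemma gen_harmonicS (R : realType) (m n : nat) :
  gen_harmonic R m n.+1 = gen_harmonic R m n + n.+1%:R ^- m.
Proof. by rewrite /gen_harmonic big_nat_recr. Qed.

Lemma inv_natX_gt0 (R : realType) (m n : nat) : 0 < n.+1%:R ^- m :> R.
Proof. by rewrite invr_gt0 exprn_gt0 ?ltr0n. Qed.

Lemma gen_harmonic_gt0 (R : realType) (m n : nat) : 0 < gen_harmonic R m n.+1.
Proof.
elim: n => [|n IH]; rewrite gen_harmonicS.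
  by rewrite /gen_harmonic big_geq // add0r inv_natX_gt0.
by rewrite addr_gt0 ?inv_natX_gt0.
Qed.

Lemma inv_natX_nonincr (R : realType) (m n : nat) :
  n.+2%:R ^- m <= n.+1%:R ^- m :> R.
Proof.
rewrite lef_pV2 ?posrE ?exprn_gt0 ?ltr0n //.
by rewrite lerXn2r ?nnegrE ?ler0n // ler_nat.
Qed.

(** Both sides are [m]-th powers, so the claim reduces to [(n+1)(n+3) <= (n+2)^2]. *)
Lemma inv_natX_log_convex (R : realType) (m n : nat) :
  (n.+2%:R ^- m) ^+ 2 <= n.+1%:R ^- m * n.+3%:R ^- m :> R.
Proof.
rewrite -!exprVn exprAC -exprMn lerXn2r ?nnegrE ?mulr_ge0 ?exprn_ge0 ?invr_ge0 ?ler0n //.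
rewrite exprVn -invfM lef_pV2 ?posrE ?mulr_gt0 ?exprn_gt0 ?ltr0n //.
by rewrite -natrM -natrX ler_nat; lia.
Qed.

(** Log-convexity and AM-GM: [(2b)^2 <= 4ac <= (a + c)^2]. *)
Lemma inv_natX_convex (R : realType) (m n : nat) :
  n.+2%:R ^- m *+ 2 <= n.+1%:R ^- m + n.+3%:R ^- m :> R.
Proof.
have := inv_natX_log_convex R m n.
have := inv_natX_gt0 R m n; have := inv_natX_gt0 R m n.+1.
have := inv_natX_gt0 R m n.+2.
move: (n.+1%:R ^- m) (n.+2%:R ^- m) (n.+3%:R ^- m) => a b c c0 b0 a0 bac.
rewrite -(@ler_pXn2r _ 2) ?nnegrE ?mulrn_wge0 ?(ltW b0) ?addr_ge0 ?(ltW a0) ?(ltW c0) //.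
rewrite -subr_ge0.
have -> : (a + c) ^+ 2 - (b *+ 2) ^+ 2 = (a - c) ^+ 2 + (a * c - b ^+ 2) *+ 4 by ring.
by rewrite addr_ge0 ?sqr_ge0 ?mulrn_wge0 ?subr_ge0.
Qed.

(** [h - a], [h], [h + b], [h + b + c] stand for four consecutive harmonic numbers. *)
Lemma ratio_sq_le (R : realFieldType) (h a b c : R) :
  0 < h - a -> 0 < h -> 0 < b -> b <= a -> b *+ 2 <= a + c ->
  ((h + b) / h) ^+ 2 <= h / (h - a) * ((h + b + c) / (h + b)).
Proof.
move=> ha0 h0 b0 ba bac.
have hb0 : 0 < h + b by rewrite addr_gt0.
rewrite expr_div_n mulf_div ler_pdivrMr ?exprn_gt0 // mulrAC.
rewrite ler_pdivlMr ?mulr_gt0 // -subr_ge0.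
(* Splitting [3a - b] as [2a + (a - b)] leaves only sums and products of nonnegative factors. *)
have -> : h * (h + b + c) * h ^+ 2 - (h + b) ^+ 2 * ((h - a) * (h + b)) =
  h ^+ 3 * (a + c - b *+ 2) + 3 * h ^+ 2 * b * (a - b)
  + h * b ^+ 2 * (2 * a + (a - b)) + a * b ^+ 3 by ring.
have a0 : 0 < a by apply: lt_le_trans ba.
have ab0 : 0 <= a - b by rewrite subr_ge0.
have abc0 : 0 <= a + c - b *+ 2 by rewrite subr_ge0.
have [h0' b0' a0'] := And3 (ltW h0) (ltW b0) (ltW a0).
by do ?[done | apply: addr_ge0 | apply: mulr_ge0 | apply: exprn_ge0].
Qed.

Theorem theorem3p7 (R : realType) (m : nat) (hm : (1 <= m)%N) :
  ratio_log_convex 1 (fun n : nat => gen_harmonic R m n).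
Proof.
split; first by case=> // n _; apply: gen_harmonic_gt0.
split; first by case=> // n _; rewrite divr_gt0 ?addn1 ?gen_harmonic_gt0.
(* The index is at least 2, so its predecessor is positive and the smallest harmonic number involved
   is [H_{n+1,m} > 0]. *)
case=> [|[|n]] // _.
rewrite subn1 !addn1 /= (gen_harmonicS _ _ n.+3) (gen_harmonicS _ _ n.+2).
(* With [h = H_{n+2,m}], this is the term [h - a]. *)
have Hn : gen_harmonic R m n.+1 = gen_harmonic R m n.+2 - n.+2%:R ^- m.
  by rewrite (gen_harmonicS _ _ n.+1) addrK.
rewrite Hn; apply: ratio_sq_le.
- by rewrite -Hn gen_harmonic_gt0.
- exact: gen_harmonic_gt0.
- exact: inv_natX_gt0.
- exact: inv_natX_nonincr.
- exact: inv_natX_convex.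
Qed.
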